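(* Let $g\in\mathcal{F}_0$ and $f\in\mathcal{F}_1$. The almost-Riordan array $(1\,|\,g,f)$ is totally positive if and only if the Riordan array $(g,f)$ is totally positive.
   Context: For $k\ge 0$, $\mathcal{F}_k$ denotes the set of formal power series $\sum_{n\ge k}a_nt^n$ with real coefficients and $a_k\neq 0$. All matrices are infinite, with rows and columns indexed by $0,1,2,\dots$; writing a matrix as a list $(u_0,u_1,u_2,\dots)$ of formal power series means that the $(n,k)$ entry is the coefficient of $t^n$ in $u_k$. The Riordan array is $(g,f)=(g,gf,gf^2,\dots)$. The almost-Riordan array is $(d\,|\,g,f)=(d,tg,tgf,tgf^2,\dots)$; here $d$ is the constant series $1$. An infinite matrix is totally positive (TP) if its minors of all orders are nonnegative. *)

(* Defs.v *)
From HB Require Import structures.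
From mathcomp Require Import all_boot all_order all_algebra.
From mathcomp Require Import reals.

Set Implicit Arguments.
Unset Strict Implicit.
Unset Printing Implicit Defensive.

Import Order.TTheory GRing.Theory Num.Theory.
Local Open Scope ring_scope.

(* A formal power series is its coefficient sequence: [u n] is the coefficient
   of t^n. *)
Definition fps (R : realType) : Type := nat -> R.

Definition fps1 (R : realType) : fps R := fun n => (n == 0)%N%:R.

Definition fpsX (R : realType) : fps R := fun n => (n == 1)%N%:R.

Definition fps_mul (R : realType) (u v : fps R) : fps R :=
  fun n => \sum_(i < n.+1) u i * v (n - i)%N.

Definition fps_exp (R : realType) (u : fps R) (k : nat) : fps R :=
  iter k (fps_mul u) (fps1 R).

(* The set F_k of series of order exactly k. *)
Definition fps_order (R : realType) (k : nat) (u : fps R) : Prop :=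
  (forall n, (n < k)%N -> u n = 0) /\ u k != 0.

Definition infmx (R : realType) : Type := nat -> nat -> R.

Definition infmx_of_cols (R : realType) (u : nat -> fps R) : infmx R :=
  fun n k => u k n.

Definition riordan (R : realType) (g f : fps R) : infmx R :=
  infmx_of_cols (fun k => fps_mul g (fps_exp f k)).

Definition almost_riordan (R : realType) (d g f : fps R) : infmx R :=
  infmx_of_cols (fun k =>
    if k is k'.+1 then fps_mul (fps_mul (fpsX R) g) (fps_exp f k') else d).

(* [r] and [c] list in increasing order the rows and columns of a minor of
   order m. *)
Definition minor (R : realType) (A : infmx R) (m : nat) (r c : 'I_m -> nat) : R :=
  \det (\matrix_(i < m, j < m) A (r i) (c j)).

Definition totally_positive (R : realType) (A : infmx R) : Prop :=
  forall (m : nat) (r c : 'I_m -> nat),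
    (forall i j : 'I_m, (i < j)%N -> (r i < r j)%N) ->
    (forall i j : 'I_m, (i < j)%N -> (c i < c j)%N) ->
    0 <= minor A r c.

(* Main.v *)
Require Import Defs.
From mathcomp Require Import all_boot all_order all_algebra.
From mathcomp Require Import reals.

(* The array (1|g,f) is the direct sum of the 1x1 matrix (1) and (g,f). A minor
   of the direct sum is therefore a minor of (g,f), or it has a zero row or
   column. *)

Set Implicit Arguments.
Unset Strict Implicit.
Unset Printing Implicit Defensive.

Import Order.TTheory GRing.Theory Num.Theory.
Local Open Scope ring_scope.

(** Multiplication by t moves each column g f^k of (g,f) down one row and leaves a 0 on top; with
    the first column 1 this gives the direct sum ([almost_riordan1E]). Minors of (g,f) are exactly
    the minors of the sum that avoid row 0 and column 0; a minor that uses both equals the one left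
    after deleting them, and a minor that uses only one is 0 ([totally_positive_direct_sum1]). *)

Lemma fps_mulX0 (R : realType) (u v : fps R) :
  fps_mul (fps_mul (fpsX R) u) v 0 = 0.
Proof. by rewrite /fps_mul !big_ord1 /fpsX mul0r mul0r. Qed.

Lemma fps_mulXE (R : realType) (u : fps R) n :
  fps_mul (fpsX R) u n.+1 = u n.
Proof.
rewrite /fps_mul 2!big_ord_recl /fpsX /= mul0r add0r mul1r subSS subn0.
by rewrite big1 ?addr0 // => i _; rewrite mul0r.
Qed.

(** The term of index 0 in the outer convolution vanishes, since t u has no constant term; the other
    terms are those of u v shifted by one. *)
Lemma fps_mulXA (R : realType) (u v : fps R) n :
  fps_mul (fps_mul (fpsX R) u) v n.+1 = fps_mul u v n.
Proof.
rewrite {1}/fps_mul big_ord_recl {1}/fps_mul big_ord1 /fpsX !mul0r add0r.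
by apply: eq_bigr => i _; rewrite /= fps_mulXE subSS.
Qed.

Lemma almost_riordan1E (R : realType) (g f : fps R) n k :
  almost_riordan (fps1 R) g f n k =
  match n, k with
  | n'.+1, k'.+1 => riordan g f n' k'
  | 0, 0 => 1
  | _, _ => 0
  end.
Proof.
case: n k => [|n] [|k] //; rewrite /almost_riordan /infmx_of_cols.
- exact: fps_mulX0.
- exact: fps_mulXA.
Qed.

Lemma totally_positive_direct_sum1 (R : realType) (A B : infmx R) :
  (forall n k, A n k =
    match n, k with
    | n'.+1, k'.+1 => B n' k'
    | 0, 0 => 1
    | _, _ => 0
    end) ->
  totally_positive A <-> totally_positive B.
Proof.
move=> AE; split=> [tpA m r c r_inc c_inc | tpB m r c r_inc c_inc].
  have := tpA m (fun i => (r i).+1) (fun i => (c i).+1) r_inc c_inc.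
  by congr (0 <= \det _); apply/matrixP=> i j; rewrite !mxE AE.
(* Minors inside the block [B]: lowering all indices by one keeps them increasing. *)
have minor_pos p (s t : 'I_p -> nat) :
    (forall i j : 'I_p, (i < j)%N -> (s i < s j)%N) ->
    (forall i j : 'I_p, (i < j)%N -> (t i < t j)%N) ->
    (forall i, 0 < s i)%N -> (forall i, 0 < t i)%N -> 0 <= minor A s t.
  move=> s_inc t_inc s_gt0 t_gt0.
  have -> : minor A s t = minor B (fun i => (s i).-1) (fun i => (t i).-1).
    congr (\det _); apply/matrixP=> i j; rewrite !mxE AE.
    by move: (s_gt0 i) (t_gt0 j); case: (s i) (t j) => [|?] [].
  by apply: tpB => i j ij /=; rewrite ltn_predRL prednK // ?s_inc ?t_inc.
case: m r c r_inc c_inc => [|m] r c r_inc c_inc.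
  by apply: minor_pos => // -[].
(* Only the first index of an increasing list can be 0. *)
have tail_gt0 (s : 'I_m.+1 -> nat) :
    (forall i j : 'I_m.+1, (i < j)%N -> (s i < s j)%N) ->
    forall i, (0 < s (lift ord0 i))%N.
  by move=> s_inc i; apply: leq_ltn_trans (s_inc ord0 _ _).
have all_gt0 (s : 'I_m.+1 -> nat) :
    (forall i j : 'I_m.+1, (i < j)%N -> (s i < s j)%N) ->
    (0 < s ord0)%N -> forall i, (0 < s i)%N.
  by move=> s_inc s0 i; case: (unliftP ord0 i) => [j|] ->; rewrite ?tail_gt0.
have [r0|r0] := posnP (r ord0); last first.
  have [c0|c0] := posnP (c ord0); last first.
    by apply: minor_pos => //; apply: all_gt0.
  (* Column 0 of [A] is chosen without row 0, so the minor has a zero column. *)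
  rewrite /minor (expand_det_col _ ord0) big1 // => i _.
  by rewrite mxE AE c0; case: (r i) (all_gt0 r r_inc r0 i) => // ?; rewrite mul0r.
(* Row 0 of [A] is chosen: at most the leading entry of the first row is nonzero. *)
rewrite /minor (expand_det_row _ ord0) big_ord_recl big1 => [|j _]; last first.
  by rewrite mxE AE r0; case: (c _) (tail_gt0 c c_inc j) => // ?; rewrite mul0r.
(* The leading entry is 1 if column 0 is also chosen; otherwise the whole row is zero. *)
rewrite addr0 mxE AE r0; case: (c ord0) => [|?]; last by rewrite mul0r.
rewrite mul1r /cofactor expr0 mul1r.
have : 0 <= minor A (fun i => r (lift ord0 i)) (fun j => c (lift ord0 j)).
  by apply: minor_pos => [i j ij|i j ij|i|j];
    rewrite ?r_inc ?c_inc ?tail_gt0.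
by congr (0 <= \det _); apply/matrixP=> i j; rewrite !mxE.
Qed.

Theorem proposition2p2 (R : realType) (g f : fps R)
  (hg : fps_order 0 g) (hf : fps_order 1 f) :
  totally_positive (almost_riordan (fps1 R) g f) <->
  totally_positive (riordan g f).
Proof. exact/totally_positive_direct_sum1/almost_riordan1E. Qed.
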